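(* Let $X_1,\ldots,X_m$ and $Y$ be finite-dimensional Hilbert spaces and set $\mathcal H:=X_1\times\cdots\times X_m$. Let $L_i:X_i\to Y$ be linear, and consider $$\min_{x=(x_1,\ldots,x_m)}\Phi(x):=\sum_{i=1}^m\phi_i(x_i)\quad\text{subject to}\quad Lx:=\sum_{i=1}^mL_ix_i=0,$$ where every $\phi_i:X_i\to(-\infty,+\infty]$ is closed, proper, convex, and piecewise linear--quadratic. Set $S:=\ker L$ and $\mathcal M:=\partial\Phi$. Suppose that there are $\tilde x\in\mathcal H$ and $\tilde y\in Y$ such that $$L\tilde x=0,\qquad-L_i^*\tilde y\in\partial\phi_i(\tilde x_i)\quad(i=1,\ldots,m).$$ Then, for every pair of brackets $S_0\subset S\subset S_1$ (subspaces of $\mathcal H$), the mapping $\mathcal A_*=(\mathcal M^\#)_*$ is maximal monotone, and the semidefinite progressive decoupling step is implementable.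
   Context: $P_V$ is the orthogonal projection onto a subspace $V$. A function is piecewise linear--quadratic if its domain is a union of finitely many polyhedral convex sets, relative to each of which it is given by a (at most) quadratic polynomial expression. Spingarn's partial inverse $\mathcal A=\mathcal M^\#$ with respect to $S$: $(x^\#,u^\#)\in\operatorname{gph}\mathcal A$ if and only if some $(z,w)\in\operatorname{gph}\mathcal M$ satisfies $x^\#=P_Sz+P_{S^\perp}w$ and $u^\#=P_Sw+P_{S^\perp}z$. For brackets $S_0\subset S\subset S_1$, let $K_0:=S\cap S_0^\perp$, $K_1:=S^\perp\cap S_1$, $H_*:=S_0\oplus S_1^\perp$, $H_{**}:=K_0\oplus K_1$, so that $\mathcal H=H_*\oplus H_{**}$ orthogonally; write elements of $\mathcal H$ as $(x_*,x_{**})$ accordingly. The projected mapping $\mathcal A_*:H_*\rightrightarrows H_*$ is defined by $u_*\in\mathcal A_*(x_* )\iff\exists x_{**}\in H_{**}$ such that $(u_*,0)\in\mathcal A(x_*,x_{**})$. The semidefinite progressive decoupling step associated with the brackets, a stepsize $c>0$ and self-adjoint positive definite $A:S_0\to S_0$, $C:S_1^\perp\to S_1^\perp$ is: given $x\in\mathcal H$, find $x^+\in\mathcal H$ with $0\in\mathcal A(x^+)+c^{-1}B(x^+-x)$, where $B:=AP_{S_0}+C^{-1}P_{S_1^\perp}$. Implementable means that this inclusion has at least one solution $x^+$ for every $x\in\mathcal H$ (here for any choice of $c$, $A$, $C$). *)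

(* Defs.v *)
From HB Require Import structures.
From mathcomp Require Import all_boot all_order all_algebra.
From mathcomp Require Import boolp classical_sets reals constructive_ereal.
Set Implicit Arguments.
Unset Strict Implicit.
Unset Printing Implicit Defensive.
Import Order.TTheory GRing.Theory Num.Theory.
Local Open Scope ring_scope.
Local Open Scope classical_set_scope.

HB.mixin Record Vector_hasInner (R : realType) (V : Type) of Vector R V := {
  inner : {dot V for (@idfun R)}
}.

#[short(type="finHilbertType")]
HB.structure Definition FinHilbert (R : realType) :=
  { V of Vector R V & Vector_hasInner R V }.

HB.factory Record Vector_isFinHilbert (R : realType) (V : Type)
    of Vector R V := {
  innerf : V -> V -> R;
  innerfC : forall x y, innerf x y = innerf y x;
  innerfPl : forall (a : R) x y z, innerf (a *: x + y) z = a * innerf x z + innerf y z;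
  innerf_gt0 : forall x, x != 0 -> 0 < innerf x x
}.

HB.builders Context R V of Vector_isFinHilbert R V.

Fact innerf_bilinear :
  bilinear_for (GRing.Scale.Law.clone _ _ *%R _)
    (GRing.Scale.Law.clone _ _ (@idfun R \; *%R) _) (innerf : V -> V -> R).
Proof.
split=> [z a x y|z a x y] /=; first by rewrite innerfPl.
by rewrite innerfC innerfPl !(innerfC z).
Qed.

HB.instance Definition _ := @bilinear_isBilinear.Build R V V R
  _ _ (innerf : V -> V -> R) innerf_bilinear.

Fact innerf_hermitian (x y : V) : innerf x y = (-1) ^+ false * idfun (innerf y x).
Proof. by rewrite expr0 mul1r innerfC. Qed.

HB.instance Definition _ :=
  @isHermitianSesquilinear.Build R V false idfun (innerf : V -> V -> R)
    innerf_hermitian.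
HB.instance Definition _ :=
  @isDotProduct.Build R V (innerf : V -> V -> R) innerf_gt0.

HB.instance Definition _ :=
  Vector_hasInner.Build R V ((innerf : V -> V -> R) : {dot V for (@idfun R)}).

HB.end.

Section Inner.
Variables (R : realType) (V : finHilbertType R).
Implicit Types (x y z : V) (U : {vspace V}).

Lemma innerC x y : inner x y = inner y x.
Proof. by rewrite (hermC inner) expr0 mul1r. Qed.

Lemma innerPl (a : R) x y z : inner (a *: x + y) z = a * inner x z + inner y z.
Proof. by rewrite linearDl linearZl_LR. Qed.

Lemma inner_gt0 x : x != 0 -> 0 < inner x x.
Proof. exact: neq0_dnorm_gt0. Qed.

Definition hnorm x : R := Num.sqrt (inner x x).

Definition ocompl U : {vspace V} := orthov inner U.

(* [daddv_pi U W] is the projection onto [U] along [W]; see [oprojP]. *)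
Definition oproj U : 'End(V) := daddv_pi U (ocompl U).

Lemma ocomplP U x : reflect (forall v, v \in U -> inner x v = 0) (x \in ocompl U).
Proof. exact: mem_orthovP. Qed.

Lemma cap_ocompl U : (U :&: ocompl U = 0)%VS.
Proof.
apply/eqP; rewrite -subv0; apply/subvP => x; rewrite memv_cap => /andP[xU].
move=> /ocomplP/(_ _ xU) x0; rewrite memv0; apply: contraT => /inner_gt0.
by rewrite x0 ltxx.
Qed.

Definition coords U x : 'rV[R]_(\dim U) := \row_i inner x (vbasis U)`_i.

Fact coords_linear U : linear (coords U).
Proof. by move=> a x y; apply/rowP => i; rewrite !mxE innerPl. Qed.

HB.instance Definition _ U :=
  GRing.isLinear.Build R V 'rV[R]_(\dim U) *:%R (coords U) (coords_linear U).

Lemma lker_coords U : (lker (linfun (coords U)) = ocompl U)%VS.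
Proof.
apply/vspaceP => x; rewrite memv_ker lfunE; apply/eqP/ocomplP => /= [x0 v vU|x0].
  rewrite (coord_vbasis vU) linear_sumr big1 // => i _.
  have /rowP/(_ i) := x0; rewrite !mxE /= => xi0.
  by rewrite [LHS]linearZr_LR /= xi0 mulr0.
by apply/rowP => i; rewrite !mxE x0 // vbasis_mem // memt_nth.
Qed.

Lemma add_ocompl U : (U + ocompl U = fullv)%VS.
Proof.
apply/eqP; rewrite eqEdim subvf /= dimv_disjoint_sum ?cap_ocompl //.
have := limg_ker_dim (linfun (coords U)) fullv; rewrite capfv lker_coords => <-.
rewrite addnC leq_add2r (leq_trans (dimvS (subvf _))) // dimvf.
by rewrite dim_matrix mul1r.
Qed.

Lemma oprojP U x :
  oproj U x \in U /\ forall v, v \in U -> inner (x - oproj U x) v = 0.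
Proof.
have xE : oproj U x + daddv_pi (ocompl U) U x = x.
  by rewrite daddv_pi_add ?cap_ocompl ?add_ocompl ?memvf.
split; first exact: memv_pi.
by apply/ocomplP; rewrite -{1}xE addrC addKr memv_pi.
Qed.

Lemma riesz (f : V -> R) : linear_for *%R f ->
  exists x, forall z, inner x z = f z.
Proof.
move=> flin; pose g := HB.pack_for {linear V -> R^o} f
  (GRing.isLinear.Build R V R^o *:%R f flin).
have f0 : lker (linfun (coords fullv)) == 0%VS.
  by rewrite lker_coords -[ocompl _]capfv cap_ocompl.
have := limg_ker_dim (linfun (coords fullv)) fullv.
rewrite (eqP f0) capv0 dimv0 add0n => lim.
have : \row_i f (vbasis {:V})`_i \in limg (linfun (coords fullv)).
  suff -> : limg (linfun (coords fullv)) = fullv by rewrite memvf.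
  apply/eqP; rewrite eqEdim subvf lim /= !dimvf.
  by rewrite dim_matrix mul1r.
case/memv_imgP => x _; rewrite lfunE /= => /rowP xE; exists x => z.
have -> : f z = \sum_i coord (vbasis {:V}) i z * f (vbasis {:V})`_i.
  rewrite {1}(coord_vbasis (memvf z)) -[LHS]/(g _) linear_sum.
  by apply: eq_bigr => i _; rewrite linearZ.
rewrite {1}(coord_vbasis (memvf z)) linear_sumr; apply: eq_bigr => i _.
by have := xE i; rewrite !mxE /= => xi; rewrite [LHS]linearZr_LR /= xi.
Qed.

End Inner.

Section Adjoint.
Variables (R : realType) (V W : finHilbertType R).

(* The vector exists and is unique; see [adjointP]. *)
Definition adjoint (f : 'Hom(V, W)) (y : W) : V :=
  xget 0 [set x | forall z, inner x z = inner y (f z)].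

Lemma adjointP f y z : inner (adjoint f y) z = inner y (f z).
Proof.
rewrite /adjoint; case: xgetP => [x _ /(_ z) //|none].
have [a u v|x xP] := @riesz _ V (fun z => inner y (f z)).
  by rewrite linearP linearPr.
by case: (none x).
Qed.

End Adjoint.

HB.instance Definition _ (R : realType) (V : finHilbertType R) (U : {vspace V}) :=
  Vector_isFinHilbert.Build R (subvs_of U)
    (fun x y => innerC (vsval x) (vsval y))
    (fun a x y z => innerPl a (vsval x) (vsval y) (vsval z))
    (fun x x0 => inner_gt0 (x0 : vsval x != 0)).

Lemma subvs_innerE (R : realType) (V : finHilbertType R) (U : {vspace V})
  (x y : subvs_of U) : inner x y = inner (vsval x) (vsval y).
Proof. by []. Qed.

Definition hprod (R : realType) m (X : 'I_m -> finHilbertType R) : Type :=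
  {dffun forall i, X i}.

Section Product.
Variables (R : realType) (m : nat) (X : 'I_m -> finHilbertType R).
Implicit Types x y z : hprod X.

HB.instance Definition _ :=
  Choice.copy (hprod X) {dffun forall i, (X i : choiceType)}.

Definition hpmk (f : forall i, X i) : hprod X := finfun f.

Lemma hpmkE f (i : 'I_m) : hpmk f i = f i.
Proof. exact: ffunE. Qed.

Lemma hprodP x y : (forall i : 'I_m, x i = y i) <-> x = y.
Proof. by split=> [xy|->//]; apply/ffunP => i; exact: xy. Qed.

Definition hpadd x y := hpmk (fun i => x i + y i).
Definition hpopp x := hpmk (fun i => - x i).
Definition hpzero := hpmk (fun=> 0).
Definition hpscale (a : R) x := hpmk (fun i => a *: x i).

Fact hpaddA : associative hpadd.
Proof. by move=> x y z; apply/hprodP => i; rewrite !hpmkE addrA. Qed.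
Fact hpaddC : commutative hpadd.
Proof. by move=> x y; apply/hprodP => i; rewrite !hpmkE addrC. Qed.
Fact hpadd0 : left_id hpzero hpadd.
Proof. by move=> x; apply/hprodP => i; rewrite !hpmkE add0r. Qed.
Fact hpaddN : left_inverse hpzero hpopp hpadd.
Proof. by move=> x; apply/hprodP => i; rewrite !hpmkE addNr. Qed.
HB.instance Definition _ :=
  GRing.isZmodule.Build (hprod X) hpaddA hpaddC hpadd0 hpaddN.

Fact hpscaleA a b x : hpscale a (hpscale b x) = hpscale (a * b) x.
Proof. by apply/hprodP => i; rewrite !hpmkE scalerA. Qed.
Fact hpscale1 : left_id 1 hpscale.
Proof. by move=> x; apply/hprodP => i; rewrite !hpmkE scale1r. Qed.
Fact hpscaleDr : right_distributive hpscale +%R.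
Proof. by move=> a x y; apply/hprodP => i; rewrite !hpmkE scalerDr. Qed.
Fact hpscaleDl x : {morph hpscale^~ x : a b / a + b}.
Proof. by move=> a b; apply/hprodP => i; rewrite !hpmkE scalerDl. Qed.
HB.instance Definition _ := GRing.Zmodule_isLmodule.Build R (hprod X)
  hpscaleA hpscale1 hpscaleDr hpscaleDl.

Lemma hpD x y (i : 'I_m) : (x + y) i = x i + y i. Proof. exact: hpmkE. Qed.
Lemma hpN x (i : 'I_m) : (- x) i = - x i. Proof. exact: hpmkE. Qed.
Lemma hp0 (i : 'I_m) : (0 : hprod X) i = 0. Proof. exact: hpmkE. Qed.
Lemma hpZ (a : R) x (i : 'I_m) : (a *: x) i = a *: x i. Proof. exact: hpmkE. Qed.

Lemma hpP (a : R) x y (i : 'I_m) : (a *: x + y) i = a *: x i + y i.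
Proof. by rewrite hpD hpZ. Qed.

Import VectorInternalTheory.

Fact hprod_vect_iso : Vector.axiom (\sum_i dim (X i)) (hprod X).
Proof.
exists (fun x => \mxrow_i v2r (x i)).
  move=> a x y; rewrite -mul_scalar_mx mul_mxrow -mxrowD; apply/eq_mxrowP => i.
  rewrite mul_scalar_mx; apply: etrans (linearP v2r a (x i) (y i)).
  by congr v2r; exact: hpP.
exists (fun r => hpmk (fun i => r2v (submxrow r i))) => [x|r].
  by apply/hprodP => i; rewrite hpmkE mxrowK v2rK.
by apply/mxrowP => i; rewrite mxrowK hpmkE r2vK.
Qed.
HB.instance Definition _ :=
  Lmodule_hasFinDim.Build R (hprod X) hprod_vect_iso.

Definition hpinner x y : R := \sum_i inner (x i) (y i).

Fact hpinnerC x y : hpinner x y = hpinner y x.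
Proof. by apply: eq_bigr => i _; rewrite innerC. Qed.
Fact hpinnerPl (a : R) x y z :
  hpinner (a *: x + y) z = a * hpinner x z + hpinner y z.
Proof.
rewrite mulr_sumr -big_split /=; apply: eq_bigr => i _.
by rewrite hpP innerPl.
Qed.
Fact hpinner_gt0 x : x != 0 -> 0 < hpinner x x.
Proof.
move=> x0; have ge0 i : 0 <= inner (x i) (x i).
  have [->|/inner_gt0/ltW //] := eqVneq (x i) 0.
  by rewrite linear0l.
rewrite lt_def sumr_ge0 // andbT; apply: contra x0 => /eqP s0.
apply/eqP/hprodP => i; rewrite hp0; apply/eqP; apply: contraT => /inner_gt0.
have /(_ i isT) -> := @psumr_eq0P _ _ predT _ (fun i _ => ge0 i) s0.
by rewrite ltxx.
Qed.
HB.instance Definition _ := Vector_isFinHilbert.Build R (hprod X)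
  hpinnerC hpinnerPl hpinner_gt0.

Lemma hprod_innerE x y : inner x y = \sum_i inner (x i) (y i).
Proof. by []. Qed.

Definition sumlfun (Y : finHilbertType R) (L : forall i, 'Hom(X i, Y)) :
  'Hom(hprod X, Y) := linfun (fun x : hprod X => \sum_i L i (x i)).

Lemma sumlfunE (Y : finHilbertType R) (L : forall i, 'Hom(X i, Y)) x :
  sumlfun L x = \sum_i L i (x i).
Proof.
pose f x := \sum_i L i (x i).
have flin : linear f.
  move=> a u v; rewrite /f scaler_sumr -big_split; apply: eq_bigr => i _.
  by rewrite hpP linearP.
pose g := HB.pack_for {linear hprod X -> Y} f
  (GRing.isLinear.Build R (hprod X) Y *:%R f flin).
exact: (lfunE g x).
Qed.

Definition sepsum (phi : forall i, X i -> \bar R) x : \bar R :=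
  (\sum_i phi i (x i))%E.

End Product.

Section ConvexAnalysis.
Variables (R : realType) (V : finHilbertType R).
Implicit Types (f : V -> \bar R) (C : set V) (q : V -> R).

Definition edom f : set V := [set x | (f x < +oo)%E].

Definition proper_fun f := (forall x, f x != -oo%E) /\ edom f !=set0.

(* Closedness is lower semicontinuity, for the topology of the Hilbert norm. *)
Definition closed_fun f := forall x (a : R), (a%:E < f x)%E ->
  exists2 e : R, 0 < e & forall y, hnorm (y - x) < e -> (a%:E < f y)%E.

(* The right-hand side is meaningful when [f] never takes the value -oo; see
   [proper_fun]. *)
Definition convex_fun f := forall (x y : V) (t : R), 0 < t -> t < 1 ->
  (f (t *: x + (1 - t) *: y)%R <= t%:E * f x + (1 - t)%:E * f y)%E.

Definition polyhedral C := exists s : seq (V * R),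
  C = [set x | forall p, p \in s -> inner p.1 x <= p.2].

Definition quadratic q := exists (Q : 'End(V)) (b : V) (c : R),
  forall x, q x = inner (Q x) x + inner b x + c.

Definition piecewise_linquad f :=
  exists (n : nat) (C : 'I_n -> set V) (q : 'I_n -> V -> R),
    [/\ forall k, polyhedral (C k) /\ quadratic (q k),
        edom f = \bigcup_k C k
      & forall k x, C k x -> f x = (q k x)%:E].

Definition subdiff f (x : V) : set V :=
  [set u | f x \is a fin_num /\
    forall y, (f x + (inner u (y - x)%R)%:E <= f y)%E].

End ConvexAnalysis.

Section Mappings.
Variables (R : realType) (V : finHilbertType R).
Implicit Types (A M : V -> set V).

Definition monotone A := forall x y u v,
  A x u -> A y v -> 0 <= inner (x - y) (u - v).

Definition maximal_monotone A := monotone A /\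
  forall M, monotone M -> (forall x, A x `<=` M x) -> M = A.

Definition selfadjoint (T : 'End(V)) :=
  forall x y, inner (T x) y = inner x (T y).

Definition posdef (T : 'End(V)) := forall x, x != 0 -> 0 < inner (T x) x.

Definition partial_inverse (S : {vspace V}) M : V -> set V :=
  fun x => [set u | exists z w, [/\ M z w,
    x = oproj S z + oproj (ocompl S) w & u = oproj S w + oproj (ocompl S) z]].

End Mappings.

Section Decoupling.
Variables (R : realType) (V : finHilbertType R) (S0 S S1 : {vspace V}).
Implicit Types A : V -> set V.

Definition Hstar : {vspace V} := (S0 + ocompl S1)%VS.

Definition Hstarstar : {vspace V} := ((S :&: ocompl S0) + (ocompl S :&: S1))%VS.

(* The pair (x_*, x_** ) is identified with the sum x_* + x_** in V. *)
Definition projected_map A : subvs_of Hstar -> set (subvs_of Hstar) :=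
  fun x => [set u | exists y : subvs_of Hstarstar, A (vsval x + vsval y) (vsval u)].

(* [vsproj U] restricts the codomain of [oproj U] to [U], on which it is the
   identity; [C^-1] is the inverse of a bijective linear map. *)
Definition step_op (A : 'End(subvs_of S0)) (C : 'End(subvs_of (ocompl S1)))
    (x : V) : V :=
  vsval (A (vsproj S0 (oproj S0 x))) +
  vsval ((C^-1)%VF (vsproj (ocompl S1) (oproj (ocompl S1) x))).

(* 0 \in A(xp) + c^-1 B(xp - x) *)
Definition decoupling_step A (c : R) (As : 'End(subvs_of S0))
    (Cs : 'End(subvs_of (ocompl S1))) (x xp : V) :=
  exists2 u, A xp u & u + c^-1 *: step_op As Cs (xp - x) = 0.

Definition implementable A :=
  forall (c : R) (As : 'End(subvs_of S0)) (Cs : 'End(subvs_of (ocompl S1))),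
    0 < c -> selfadjoint As -> posdef As -> selfadjoint Cs -> posdef Cs ->
  forall x, exists xp, decoupling_step A c As Cs x xp.

End Decoupling.

Arguments projected_map {R V} S0 S S1 A _ _.
Arguments implementable {R V} S0 S1 A.

(* Main.v *)
From HB Require Import structures.
Require Import Defs.
From mathcomp Require Import all_boot all_order all_algebra.
From mathcomp Require Import boolp classical_sets reals constructive_ereal.
From mathcomp Require Import ring lra.
Set Implicit Arguments.
Unset Strict Implicit.
Unset Printing Implicit Defensive.
Import Order.TTheory GRing.Theory Num.Theory.
Local Open Scope ring_scope.
Local Open Scope classical_set_scope.

(* Unwinding the partial inverse, a decoupling step amounts to minimizing
   [Phi] plus a convex quadratic, built from the metrics [A] and [C], over the
   subspace [W = S + S1^perp]. The KKT pair [(x~, - L^* y~)] bounds this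
   objective from below on [W], so the Frank-Wolfe theorem, applied to each of
   the finitely many pieces, gives a minimizer. Since the pieces are polyhedral,
   Farkas' lemma turns minimality into the optimality condition
   [0 \in subdiff Phi z + grad z + W^perp] without constraint qualification,
   and this is the step inclusion. Maximality of the projected mapping is
   Minty's criterion, from the step with identity metrics. *)

(** * Orthogonal projections, and second-order expansions of quadratics *)

Section InnerTheory.
Variables (R : realType) (V : finHilbertType R).
Implicit Types (x y z : V) (U : {vspace V}).

Lemma innerDl x y z : inner (x + y) z = inner x z + inner y z.
Proof. by rewrite -{1}[x]scale1r innerPl mul1r. Qed.

Lemma inner0l x : inner 0 x = 0.
Proof. exact: linear0l. Qed.

Lemma innerZl (a : R) x y : inner (a *: x) y = a * inner x y.
Proof. by rewrite -{1}[a *: x]addr0 innerPl inner0l addr0. Qed.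

Lemma innerNl x y : inner (- x) y = - inner x y.
Proof. by rewrite -scaleN1r innerZl mulN1r. Qed.

Lemma innerDr x y z : inner x (y + z) = inner x y + inner x z.
Proof. by rewrite innerC innerDl !(innerC _ x). Qed.

Lemma innerZr (a : R) x y : inner x (a *: y) = a * inner x y.
Proof. by rewrite innerC innerZl innerC. Qed.

Lemma innerNr x y : inner x (- y) = - inner x y.
Proof. by rewrite innerC innerNl innerC. Qed.

Lemma inner0r x : inner x 0 = 0.
Proof. by rewrite innerC inner0l. Qed.

Definition inner_lin := (innerDl, innerDr, innerZl, innerZr, innerNl, innerNr).

Lemma inner_suml (I : finType) (f : I -> V) y :
  inner (\sum_i f i) y = \sum_i inner (f i) y.
Proof.
apply: (big_ind2 (fun a b => inner a y = b)) => //; first exact: inner0l.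
by move=> a b c d <- <-; rewrite innerDl.
Qed.

Lemma inner_eq0 x : inner x x <= 0 -> x = 0.
Proof.
move=> x0; apply/eqP; apply: contraT => /inner_gt0.
by rewrite ltNge x0.
Qed.

Lemma inner_inj x y : (forall z, inner x z = inner y z) -> x = y.
Proof.
move=> xy; apply/eqP; rewrite -subr_eq0; apply/eqP/inner_eq0.
by rewrite innerDl innerNl xy subrr.
Qed.

Lemma oproj_in U x : oproj U x \in U.
Proof. by case: (oprojP U x). Qed.

Lemma oproj_orth U x : x - oproj U x \in ocompl U.
Proof. by apply/ocomplP; case: (oprojP U x). Qed.

Lemma ocomplK U : ocompl (ocompl U) = U.
Proof.
apply/vspaceP => x; apply/idP/idP => [/ocomplP xU|xU].
  have xE : x - oproj U x = 0.
    apply: inner_eq0; rewrite innerDl innerNl xU ?oproj_orth // add0r oppr_le0.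
    rewrite le_eqVlt; apply/orP; left; apply/eqP/esym; rewrite innerC.
    by case: (oprojP U x) => h; apply.
  by rewrite -(subrK (oproj U x) x) xE add0r oproj_in.
by apply/ocomplP => v /ocomplP/(_ _ xU); rewrite innerC.
Qed.

Lemma ocomplS U W : (U <= W)%VS -> (ocompl W <= ocompl U)%VS.
Proof.
by move=> /subvP UW; apply/subvP => x /ocomplP xW; apply/ocomplP => v /UW/xW.
Qed.

Lemma oproj_uniq U x y : y \in U -> x - y \in ocompl U -> oproj U x = y.
Proof.
move=> yU xyU; apply/eqP; rewrite -subr_eq0 -memv0 -(cap_ocompl U) memv_cap.
rewrite memvB ?oproj_in //=.
by rewrite -(subrKA x) memvD // -memvN opprB oproj_orth.
Qed.

Lemma oproj_id U x : x \in U -> oproj U x = x.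
Proof. by move=> xU; apply: oproj_uniq; rewrite // subrr mem0v. Qed.

Lemma oproj_ortho0 U x : x \in ocompl U -> oproj U x = 0.
Proof. by move=> xU; apply: oproj_uniq; rewrite ?mem0v ?subr0. Qed.

Lemma oproj_add U x : oproj U x + oproj (ocompl U) x = x.
Proof.
rewrite (@oproj_uniq (ocompl U) x (x - oproj U x)) ?oproj_orth //.
  by rewrite addrC subrK.
by rewrite ocomplK opprB addrC subrK oproj_in.
Qed.

Lemma inner_orth U x y : x \in U -> y \in ocompl U -> inner x y = 0.
Proof. by move=> xU /ocomplP/(_ _ xU); rewrite innerC. Qed.

Lemma oproj_innerl U x y : inner (oproj U x) y = inner (oproj U x) (oproj U y).
Proof.
rewrite -{1}(oproj_add U y) innerDr.
by rewrite [X in _ + X](inner_orth (oproj_in U x) (oproj_in _ y)) addr0.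
Qed.

Lemma oproj_sym U x y : inner (oproj U x) y = inner x (oproj U y).
Proof. by rewrite oproj_innerl innerC -oproj_innerl innerC. Qed.

Lemma oproj_oproj U W x : (U <= W)%VS -> oproj U (oproj W x) = oproj U x.
Proof.
move=> UW; rewrite -{2}(oproj_add W x) linearD /=.
rewrite [X in _ + X]oproj_ortho0 ?addr0 //.
by apply: (subvP (ocomplS UW)); exact: oproj_in.
Qed.

Lemma adjoint_linear (f : 'End(V)) : linear (adjoint f).
Proof.
move=> a x y; apply: inner_inj => z.
by rewrite adjointP !inner_lin !adjointP.
Qed.

HB.instance Definition _ (f : 'End(V)) :=
  GRing.isLinear.Build R V V *:%R (adjoint f) (adjoint_linear f).

(* Quadratics enter the argument only through this exact second-order
   expansion, whose gradient map [T x + b] has a symmetric linear part. *)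
Definition expands (T : 'End(V)) (b : V) (q : V -> R) := forall x d (t : R),
  q (x + t *: d) = q x + t * inner (T x + b) d + t ^+ 2 * (inner (T d) d / 2).

Lemma quadratic_expands (q : V -> R) :
  quadratic q -> exists T b, selfadjoint T /\ expands T b q.
Proof.
move=> [Q [b [c qE]]].
(* [Q] need not be self-adjoint; its symmetrization [Q + Q^*] is the Hessian, which explains the
   factor 1/2 in [expands]. *)
exists (Q + linfun (adjoint Q)), b; split=> [x y|x d t].
  rewrite !lfunE /= !lfunE /= !inner_lin adjointP.
  by rewrite [inner x (adjoint Q y)]innerC adjointP addrC innerC [inner y _]innerC.
rewrite !qE !lfunE /= !lfunE /= !linearD !linearZ /= !inner_lin !adjointP.
rewrite (innerC (Q x) d) (innerC (Q d) x) (innerC (Q d) d).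
by field.
Qed.

Lemma expandsD T T' b b' (q q' : V -> R) : expands T b q -> expands T' b' q' ->
  expands (T + T') (b + b') (fun x => q x + q' x).
Proof.
by move=> qE qE' x d t; rewrite qE qE' !lfunE /= !inner_lin; field.
Qed.

End InnerTheory.

(** * Coordinate embeddings of a product space *)

Section ProductTheory.
Variables (R : realType) (m : nat) (X : 'I_m -> finHilbertType R).

(** The adjoint of the [i]-th coordinate projection, see [inner_hpinj]; it carries normals of
    constraints on a factor to normals on the product. *)
Definition hpinj i (x : X i) : hprod X :=
  hpmk (dfwith (fun j => 0 : X j) x).

Lemma hpinj_in i (x : X i) : hpinj x i = x.
Proof. by rewrite hpmkE dfwith_in. Qed.

Lemma hpinj_out i (x : X i) (j : 'I_m) : i != j -> hpinj x j = 0.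
Proof. by move=> ij; rewrite hpmkE dfwith_out. Qed.

Lemma inner_hpinj i (x : X i) (y : hprod X) : inner (hpinj x) y = inner x (y i).
Proof.
rewrite hprod_innerE (bigD1 i) //= hpinj_in big1 ?addr0 // => j ji.
by rewrite hpinj_out ?inner0l // eq_sym.
Qed.

End ProductTheory.

(** * Attainment of minima *)

Section Attains.
Variables (R : realType) (T : Type).
Implicit Types (P : set T) (q : T -> R).

(** Vacuous on the empty set, so that empty pieces and facets are harmless in finite unions. *)
Definition attains P q :=
  P !=set0 -> exists2 x, P x & forall y, P y -> q x <= q y.

Lemma attains_dominated P P' q : P' `<=` P ->
  (forall x, P x -> exists2 y, P' y & q y <= q x) ->
  attains P' q -> attains P q.
Proof.
move=> P'P dom P'q [x0 /dom[y0 P'y0 _]].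
have [x P'x xmin] := P'q (ex_intro _ y0 P'y0).
exists x => [|y /dom[z P'z zy]]; first exact: P'P.
exact: le_trans (xmin _ P'z) zy.
Qed.

Lemma attains_ext P q q' : (forall x, P x -> q x = q' x) ->
  attains P q -> attains P q'.
Proof.
move=> qq' Pq /Pq[x Px xmin]; exists x => // y Py.
by rewrite -!qq' //; exact: xmin.
Qed.

Lemma attains_bigcup (I : eqType) (s : seq I) (P : I -> set T) q :
  (forall i, i \in s -> attains (P i) q) ->
  attains [set x | exists2 i, i \in s & P i x] q.
Proof.
elim: s => [_ [x [i]]//|i s IHs sP].
have {IHs}IH := IHs (fun j js => sP j (@mem_behead _ (i :: s) j js)).
have {sP}iP := sP i (mem_head _ _).
have [[x0 Px0]|no] := pselect (P i !=set0); last first.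
  move=> [x [j]]; rewrite inE => /orP[/eqP->|js] Pjx; first by case: no; exists x.
  have [|y [k ks Pky] ymin] := IH; first by exists x, j.
  exists y => [|z [l]]; first by exists k; rewrite // inE ks orbT.
  rewrite inE => /orP[/eqP->|ls] Plz; first by case: no; exists z.
  by apply: ymin; exists l.
move=> _; have [x Px xmin] := iP (ex_intro _ x0 Px0).
have [ne|no] := pselect ([set x | exists2 i, i \in s & P i x] !=set0); last first.
  exists x => [|z [l]]; first by exists i; rewrite ?mem_head.
  rewrite inE => /orP[/eqP->|ls] Plz; first exact: xmin.
  by case: no; exists z, l.
have [y [k ks Pky] ymin] := IH ne.
have [xy|yx] := leP (q x) (q y).
  exists x => [|z [l]]; first by exists i; rewrite ?mem_head.
  rewrite inE => /orP[/eqP->|ls] Plz; first exact: xmin.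
  by apply: le_trans xy _; apply: ymin; exists l.
exists y => [|z [l]]; first by exists k; rewrite // inE ks orbT.
rewrite inE => /orP[/eqP->|ls] Plz; last by apply: ymin; exists l.
by apply: le_trans (ltW yx) _; exact: xmin.
Qed.

End Attains.

(** * Polyhedra, and the Frank-Wolfe theorem *)

Section Polyhedra.
Variables (R : realType) (V : finHilbertType R).
Implicit Types (x y d : V) (s : seq (V * R)) (W : {vspace V}).

Definition polyh s : set V := [set x | forall p, p \in s -> inner p.1 x <= p.2].

Lemma polyh_cons p s x : polyh (p :: s) x <-> inner p.1 x <= p.2 /\ polyh s x.
Proof.
split=> [ps|[px sx] p'].
  by split=> [|p' p's]; apply: ps; rewrite inE ?eqxx ?p's ?orbT.
by rewrite inE => /predU1P[->//|/sx].
Qed.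

Lemma polyh_segment s x d (t u : R) : polyh s x -> polyh s (x + u *: d) ->
  0 <= t <= u -> polyh s (x + t *: d).
Proof.
move=> sx sxu tu p ps; have := sx p ps; have := sxu p ps.
rewrite !inner_lin; move/andP: tu => [t0 tu].
by have [c0|c0] := leP 0 (inner p.1 d); nra.
Qed.

(** By induction on the constraints: a new constraint either is met after the previous exit point,
    or provides an earlier one. The positive slope of the blocking constraint shows later that its
    normal is not orthogonal to the direction space. *)
Lemma polyh_ray s x d : polyh s x ->
  (forall t, 0 <= t -> polyh s (x + t *: d)) \/
  exists t p, [/\ 0 <= t, p \in s, polyh s (x + t *: d),
                  inner p.1 (x + t *: d) = p.2 & 0 < inner p.1 d].
Proof.
elim: s => [_|p s IHs]; first by left.
move=> /polyh_cons[px sx].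
(* If the old constraints hold up to [t0], where [p] is tight or violated, then the ray leaves at
   the point where [p] becomes tight. *)
have hit t0 : 0 < inner p.1 d -> 0 <= t0 ->
    (forall t, 0 <= t <= t0 -> polyh s (x + t *: d)) ->
    p.2 <= inner p.1 (x + t0 *: d) ->
  exists t p', [/\ 0 <= t, p' \in p :: s, polyh (p :: s) (x + t *: d),
                  inner p'.1 (x + t *: d) = p'.2 & 0 < inner p'.1 d].
  move=> pd t00 st0; rewrite !inner_lin => pt0.
  pose t := (p.2 - inner p.1 x) / inner p.1 d.
  have pE : inner p.1 (x + t *: d) = p.2.
    by rewrite !inner_lin /t divfK ?gt_eqF // addrC subrK.
  exists t, p; split=> //; rewrite ?mem_head //.
    by rewrite divr_ge0 ?subr_ge0 ?(ltW pd).
  apply/polyh_cons; split; first by rewrite pE.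
  apply: st0; rewrite divr_ge0 ?subr_ge0 ?(ltW pd) //= ler_pdivrMr //.
  by rewrite lerBlDl.
case: (IHs sx) => [ray|[t0 [p0 [t00 p0s st0 p0E p0d]]]].
  have [pd|pd] := lerP (inner p.1 d) 0.
    left=> t t0; apply/polyh_cons; split; last exact: ray.
    by rewrite !inner_lin; nra.
  right; apply: (hit ((p.2 - inner p.1 x) / inner p.1 d)) => //.
  - by rewrite divr_ge0 ?subr_ge0 ?(ltW pd).
  - by move=> t /andP[t0 _]; exact: ray.
  - by rewrite !inner_lin divfK ?gt_eqF // addrC subrK.
right; have [pt0|pt0] := leP (inner p.1 (x + t0 *: d)) p.2.
  by exists t0, p0; split=> //; [rewrite inE p0s orbT | apply/polyh_cons].
apply: (hit t0) => //; last exact: ltW.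
  by move: pt0; rewrite !inner_lin; nra.
by move=> t tt0; apply: polyh_segment st0 tt0.
Qed.

(* The directions of the second alternative span rays along which the
   quadratic decreases to -oo. *)
Lemma quadratic_dichotomy (T : 'End(V)) b W z0 : selfadjoint T ->
  (exists2 z, z - z0 \in W & forall d, d \in W ->
     inner (T z + b) d = 0 /\ 0 <= inner (T d) d) \/
  (forall x, x - z0 \in W -> exists d, [/\ d \in W, inner (T x + b) d <= 0,
     inner (T d) d <= 0 & inner (T x + b) d + inner (T d) d < 0]).
Proof.
move=> Tsym.
have [[d dW Td]|psd] := pselect (exists2 d, d \in W & inner (T d) d < 0).
  (* A direction of negative curvature serves every [x], up to a sign that makes the slope
     nonpositive. *)
  right=> x _; have [le0|gt0] := leP (inner (T x + b) d) 0.
    by exists d; split=> //; [exact: ltW | lra].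
  exists (- d); rewrite (linearN T) !innerNr innerNl opprK rpredN.
  split=> //; [by rewrite oppr_le0 ltW | exact: ltW |].
  by lra.
have {}psd d : d \in W -> 0 <= inner (T d) d.
  by move=> dW; rewrite leNgt; apply/negP => Td; apply: psd; exists d.
(* [U] is the range of the Hessian compressed to [W], and [g] the gradient at [z0] compressed to
   [W]; a critical point on [z0 + W] exists exactly when [g] lies in [U]. *)
pose U := ((oproj W \o T) @: W)%VS; pose g := oproj W (T z0 + b).
have [gU|gU] := boolP (g \in U).
  left; have /memv_imgP[w wW gE] := gU.
  exists (z0 - w) => [|d dW]; first by rewrite addrC addKr rpredN.
  split; last exact: psd.
  rewrite -(oproj_id dW) -oproj_sym linearB /= -addrA [- T w + b]addrC addrA.
  by rewrite linearB /= -/g gE lfunE /= subrr inner0l.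
(* Minus the component of [g] orthogonal to [U]: the compressed Hessian kills [d], so the slope
   along [d] is [- inner d d] at every point of [z0 + W]. *)
right=> x xz0; pose d := oproj U g - g.
have dU : - d \in ocompl U by rewrite opprB oproj_orth.
have UW : (U <= W)%VS.
  by apply/subvP => _ /memv_imgP[w _ ->]; rewrite lfunE /= oproj_in.
have dW : d \in W by rewrite memvB ?oproj_in // (subvP UW) ?oproj_in.
have dT w : w \in W -> inner (T w) d = 0.
  move=> wW; have TwU : oproj W (T w) \in U.
    by apply/memv_imgP; exists w; rewrite ?lfunE.
  have := inner_orth TwU dU; rewrite innerNr oproj_sym (oproj_id dW) => /eqP.
  by rewrite oppr_eq0 => /eqP.
have lt0 : inner (T x + b) d < 0.
  have -> : inner (T x + b) d = - inner d d.
    have -> : T x + b = T (x - z0) + (T z0 + b) by rewrite linearB addrA subrK.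
    rewrite innerDl dT // add0r -{1}(oproj_id dW) -oproj_sym -/g.
    have -> : g = oproj U g - d by rewrite opprB addrC subrK.
    have := inner_orth (oproj_in U g) dU; rewrite innerNr => /eqP.
    by rewrite oppr_eq0 innerDl innerNl => /eqP ->; rewrite add0r.
  rewrite oppr_lt0 inner_gt0 // subr_eq0; apply: contra gU => /eqP <-.
  exact: oproj_in.
exists d; split=> //; rewrite ?dT ?addr0 //; exact: ltW.
Qed.

(* Facets have a smaller direction space, so induction on its dimension
   proves the Frank-Wolfe theorem without compactness, even for nonconvex
   quadratics. *)
Lemma frank_wolfe (T : 'End(V)) b W z0 s (q : V -> R) :
  selfadjoint T -> expands T b q ->
  (exists m, forall x, x - z0 \in W -> polyh s x -> m <= q x) ->
  attains [set x | x - z0 \in W /\ polyh s x] q.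
Proof.
move=> Tsym qE [m qm].
have [n] := ubnP (\dim W); elim: n W z0 qm => // n IHn W z0 qm Wn.
(* The last condition guarantees that making [p] tight lowers the dimension of the direction
   space. *)
pose facet p := [set x | [/\ x - z0 \in W, polyh s x, inner p.1 x = p.2
                          & p.1 \notin ocompl W]].
pose G := [set x | exists2 p, p \in s & facet p x].
have facetP p : attains (facet p) q.
  move=> [x0 [x0W sx0 px0 pW]]; pose W' := (W :&: ocompl <[p.1]>)%VS.
  have W'E x : (x - x0 \in W') = (x - z0 \in W) && (inner p.1 x == p.2).
    rewrite memv_cap -[x - z0](subrKA x0) (rpredDr _ x0W) -px0 -subr_eq0.
    rewrite -innerNr -innerDr; congr andb; apply/ocomplP/eqP => [xp|xp v].
      by rewrite innerC xp ?memv_line.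
    by move=> /vlineP[k ->]; rewrite innerZr innerC xp mulr0.
  have [|||x [/[!W'E]/andP[xW /eqP px] sx] xmin] := IHn W' x0.
  - by move=> x /[!W'E]/andP[xW _]; exact: qm.
  - rewrite -ltnS; apply: leq_trans Wn; rewrite ltnS ltnNge; apply: contra pW => WW'.
    have /eqP W'W : W' == W by rewrite eqEdim capvSl.
    apply/ocomplP => v; rewrite -W'W memv_cap => /andP[_ /ocomplP].
    by move=> /(_ _ (memv_line _)); rewrite innerC.
  - by exists x0; split=> //; rewrite subrr mem0v.
  exists x => [//|y [yW sy py _]]; apply: xmin; split=> //.
  by rewrite W'E yW py eqxx.
have hit x d : x - z0 \in W -> d \in W -> polyh s x ->
    (forall t, 0 <= t -> polyh s (x + t *: d)) \/
    exists t, [/\ 0 <= t, polyh s (x + t *: d) & G (x + t *: d)].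
  move=> xW dW sx; have [|[t [p [t0 ps st pE pd]]]] := polyh_ray d sx.
    by left.
  right; exists t; split=> //; exists p => //; split=> //.
    by rewrite addrAC memvD // memvZ.
  by apply/negP => /ocomplP/(_ _ dW) pd0; rewrite pd0 ltxx in pd.
have GP : attains G q by apply: attains_bigcup => p _; exact: facetP.
have GsubP : G `<=` [set x | x - z0 \in W /\ polyh s x].
  by move=> x [p _ []].
have [[z zW crit]|desc] := quadratic_dichotomy b W z0 Tsym.
  have qz x : x - z0 \in W -> q x = q z + inner (T (x - z)) (x - z) / 2.
    move=> xW; have xzW : x - z \in W.
      by rewrite -(subrKA z0) memvD // -memvN opprB.
    have := qE z (x - z) 1; rewrite scale1r [z + _]addrC subrK => ->.
    by have [-> _] := crit _ xzW; rewrite mulr0 addr0 expr1n mul1r.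
  have [sz|nsz] := pselect (polyh s z).
    move=> _; exists z => // x [xW _]; rewrite (qz x xW) lerDl divr_ge0 //.
    have xzW : x - z \in W by rewrite -(subrKA z0) memvD // -memvN opprB.
    by have [] := crit _ xzW.
  (* The critical point [z] is infeasible, so the segment from a feasible [x] to [z] crosses a
     facet, and [q] does not increase on the way. *)
  apply: attains_dominated GP => // x [xW sx].
  have zxW : z - x \in W by rewrite -(subrKA z0) memvD // -memvN opprB.
  have [ray|[t [t0 st Gt]]] := hit x (z - x) xW zxW sx.
    by case: nsz; have := ray 1 ler01; rewrite scale1r addrC subrK.
  exists (x + t *: (z - x)) => //.
  have t1 : t <= 1.
    rewrite leNgt; apply/negP => /ltW t1; apply: nsz.
    have := @polyh_segment s x (z - x) 1 t sx st.
    by rewrite ler01 t1 scale1r addrC subrK; apply.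
  have [_ Tge0] := crit _ zxW; have [crit0 _] := crit _ zxW.
  (* Both [x] and the exit point are expanded around [z]; the values differ by the curvature term
     times [1 - (t - 1)^2 = t * (2 - t)]. *)
  have := qE z (z - x) (-1); have := qE z (z - x) (t - 1).
  rewrite crit0 scaleN1r opprB [z + (x - z)]addrC subrK => + ->.
  have -> : z + (t - 1) *: (z - x) = x + t *: (z - x).
    by rewrite scalerBl scale1r opprB [LHS]addrC -addrA subrK addrC.
  move=> ->; have t2 : 0 <= t * (2 - t) by rewrite mulr_ge0 //; lra.
  by have := mulr_ge0 Tge0 t2; lra.
apply: attains_dominated GP => // x [xW sx].
have [d [dW a0 c0 ac]] := desc x xW.
have [ray|[t [t0 st Gt]]] := hit x d xW dW sx.
  have mx := qm x xW sx.
  (* [delta] is the decrease over a unit step. For [t >= 1] the decrease is at least [t * delta], so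
     the chosen [t] would bring [q] down to [m - delta] or below. *)
  pose delta := - (inner (T x + b) d + inner (T d) d / 2).
  have delta0 : 0 < delta by rewrite /delta; lra.
  pose t := 1 + (q x - m) / delta.
  have t1 : 1 <= t by rewrite lerDl divr_ge0 ?subr_ge0 // ltW.
  have tE : t * delta = delta + (q x - m) by rewrite mulrDl mul1r divfK ?gt_eqF.
  have t0 : 0 <= t by rewrite (le_trans ler01).
  have := qm (x + t *: d); rewrite addrAC memvD ?memvZ // => /(_ isT (ray t t0)).
  rewrite qE; move: tE delta0; rewrite /delta.
  have : t ^+ 2 * inner (T d) d <= t * inner (T d) d.
    by rewrite expr2 -mulrA ler_neMl // mulr_ge0_le0.
  by lra.
exists (x + t *: d) => //; rewrite qE.
by move: (inner _ _) (inner _ _) a0 c0 => a c a0 c0; nra.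
Qed.

End Polyhedra.

(** * Farkas' lemma modulo a subspace *)

Section Farkas.
Variables (R : realType) (V : finHilbertType R).
Implicit Types (U : {vspace V}) (s : seq V).

(* The first alternative states that [b - u] lies in the closed cone generated
   by [s], in the dual form in which it is used. *)
Lemma farkas U s (b : V) :
  (exists2 u, u \in U &
     forall d, (forall a, a \in s -> inner d a <= 0) -> inner d (b - u) <= 0) \/
  (exists d, [/\ d \in ocompl U, forall a, a \in s -> inner d a <= 0
                & 0 < inner d b]).
Proof.
have [n] := ubnP (size s); elim: n s b => // n IHn [|a s] b /=; rewrite ltnS => sn.
  have [bU|bU] := boolP (b \in U).
    by left; exists b => // d _; rewrite subrr inner0r.
  right; exists (b - oproj U b); split=> //; first exact: oproj_orth.
  rewrite -{3}(subrK (oproj U b) b) innerDr.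
  rewrite [X in _ + X]innerC (inner_orth (oproj_in U b) (oproj_orth U b)) addr0.
  rewrite inner_gt0 // subr_eq0; apply: contra bU => /eqP->; exact: oproj_in.
case: (IHn s b sn) => [[u uU ub]|[d [dU ds db]]].
  by left; exists u => // d ds; apply: ub => c cs; apply: ds; rewrite inE cs orbT.
have [da|da] := lerP (inner d a) 0.
  by right; exists d; split=> // c; rewrite inE => /predU1P[->|/ds].
(* Project along [a] onto the hyperplane orthogonal to [d]. *)
pose pr c := c - (inner d c / inner d a) *: a.
have prE e c : inner e (pr c) = inner e c - inner d c / inner d a * inner e a.
  by rewrite /pr !inner_lin.
case: (IHn (map pr s) (pr b)) => [|[u uU ub]|[e [eU es eb]]].
- by rewrite size_map.
- left; exists u => // e es; have ea := es a (mem_head _ _).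
  have -> : b - u = (pr b - u) + (inner d b / inner d a) *: a.
    by rewrite addrAC /pr subrK.
  rewrite innerDr innerZr.
  rewrite -[leRHS]addr0 lerD //; last first.
    by rewrite mulr_ge0_le0 // divr_ge0 // ltW.
  apply: ub => _ /mapP[c cs ->]; rewrite prE.
  rewrite subr_le0 (le_trans (es c _)) // ?inE ?cs ?orbT //.
  rewrite mulr_le0 //; have := ds c cs.
  by rewrite ler_pdivrMr // mul0r.
(* [f] is the image of [e] under the adjoint of [pr]; it annihilates [a]. *)
- right; pose f := e - (inner e a / inner d a) *: d.
  have fE c : inner f c = inner e (pr c).
    by rewrite prE /f !inner_lin; field; rewrite gt_eqF.
  exists f; split; rewrite ?fE //; first by rewrite memvB ?memvZ.
  move=> c; rewrite inE => /predU1P[->|cs]; last by rewrite fE es ?map_f.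
  by rewrite fE prE divff ?gt_eqF // mul1r subrr.
Qed.

End Farkas.

(** * First-order conditions from inequalities with a quadratic error *)

Section SecondOrder.
Variable R : realType.

Lemma second_order_ge0 (a K e : R) : 0 < e ->
  (forall t, 0 < t <= e -> 0 <= t * a + t ^+ 2 * K) -> 0 <= a.
Proof.
move=> e0 H; rewrite leNgt; apply/negP => a0.
have K1 : 0 < 2 * (`|K| + 1) by rewrite mulr_gt0 // ltr_wpDl.
(* This step makes [t * |K|] at most [- a / 2], so that the linear term wins; the [+ 1] covers
   [K = 0]. *)
pose t := Num.min e (- a / (2 * (`|K| + 1))).
have t0 : 0 < t by rewrite lt_min e0 divr_gt0 ?oppr_gt0.
have te : t <= e by rewrite ge_min lexx.
have : t * (2 * (`|K| + 1)) <= - a by rewrite -ler_pdivlMr // ge_min lexx orbT.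
have := H t; rewrite t0 te expr2 -mulrA -mulrDr pmulr_rge0 // => /(_ isT).
have := ler_norm (t * K); rewrite normrM (gtr0_norm t0).
by move: (`|K|) => k; lra.
Qed.

End SecondOrder.

(** * Normal cones of polyhedra, and existence of subgradients *)

Section KKT.
Variables (R : realType) (V : finHilbertType R).
Implicit Types (x y z d w : V) (s : seq (V * R)) (W : {vspace V}).
Implicit Types (D : set V) (F : V -> R).

Definition active s z : seq V := [seq p.1 | p <- s & inner p.1 z == p.2].

(** Only a constraint with positive slope along [d] can block; it is inactive by assumption, hence
    slack at [z], and slack over slope is an admissible step. *)
Lemma active_feasible s z d : polyh s z ->
  (forall a, a \in active s z -> inner d a <= 0) ->
  exists2 e, 0 < e & forall t, 0 <= t <= e -> polyh s (z + t *: d).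
Proof.
elim: s => [_ _|p s IHs /polyh_cons[pz sz] dact]; first by exists 1.
have [|e e0 eP] := IHs sz.
  move=> a /mapP[p']; rewrite mem_filter => /andP[p'z p's] ->.
  by apply: dact; rewrite map_f // mem_filter p'z inE p's orbT.
have [pd|pd] := lerP (inner p.1 d) 0.
  exists e => // t te; apply/polyh_cons; split; last exact: eP.
  by move/andP: te => [t0 _]; rewrite !inner_lin; nra.
have {}pz : inner p.1 z < p.2.
  rewrite lt_neqAle pz andbT; apply/negP => pzE.
  have := dact p.1; rewrite map_f ?mem_filter ?pzE ?mem_head // => /(_ isT).
  by rewrite innerC leNgt pd.
exists (Num.min e ((p.2 - inner p.1 z) / inner p.1 d)) => [|t].
  by rewrite lt_min e0 divr_gt0 ?subr_gt0.
rewrite le_min ler_pdivlMr // => /and3P[t0 te tp]; apply/polyh_cons; split.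
  by rewrite !inner_lin; lra.
by apply: eP; rewrite t0.
Qed.

Lemma active_le0 s z y a : polyh s y -> a \in active s z -> inner (y - z) a <= 0.
Proof.
move=> sy /mapP[p]; rewrite mem_filter => /andP[/eqP pz ps] ->.
by rewrite innerC innerDr innerNr pz subr_le0 sy.
Qed.

Definition convex_on D F := forall x y (t : R), D x -> D y -> 0 < t < 1 ->
  D (t *: x + (1 - t) *: y) /\
  F (t *: x + (1 - t) *: y) <= t * F x + (1 - t) * F y.

(** A one-sided derivative bound, bundled with feasibility of short steps. In this form it adds up
    over directions that point into different pieces. *)
Definition slope_le D F z d r := exists e K, 0 < e /\ forall t, 0 <= t <= e ->
  D (z + t *: d) /\ F (z + t *: d) <= F z + t * r + t ^+ 2 * K.

Lemma slope_le0 D F z : D z -> slope_le D F z 0 0.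
Proof.
move=> Dz; exists 1, 0; split=> // t _.
by rewrite scaler0 !mulr0 !addr0.
Qed.

(** Convexity at the midpoint [z + t (d + d')] of [z + 2t d] and [z + 2t d']; the doubled step
    halves the radius and doubles the quadratic constant. *)
Lemma slope_leD D F z d r d' r' : convex_on D F ->
  slope_le D F z d r -> slope_le D F z d' r' -> slope_le D F z (d + d') (r + r').
Proof.
move=> Fconv [e [K [e0 eP]]] [e' [K' [e'0 eP']]].
exists (Num.min e e' / 2), (2 * (K + K')); split=> [|t].
  by rewrite divr_gt0 // lt_min e0.
rewrite ler_pdivlMr // le_min => /and3P[t0 te te'].
have tt : 0 <= t * 2 by rewrite mulr_ge0.
have [|Dd Fd] := eP (t * 2); first by rewrite tt.
have [|Dd' Fd'] := eP' (t * 2); first by rewrite tt.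
have [|] := Fconv _ _ 2^-1 Dd Dd'; first by rewrite invr_gt0 ltr0n invf_lt1 ?ltr1n.
have half : 1 - 2^-1 = 2^-1 :> R by field.
rewrite half; have -> : 2^-1 *: (z + (t * 2) *: d) + 2^-1 *: (z + (t * 2) *: d')
    = z + t *: (d + d').
  rewrite -scalerDr addrACA scalerDr -mulr2n -scaler_nat scalerA.
  rewrite mulVf ?pnatr_eq0 // scale1r -scalerDr scalerA; congr (_ + _ *: _).
  by rewrite mulrCA mulVf ?mulr1 ?pnatr_eq0.
move=> DD FF; split=> //; apply: le_trans FF _.
by lra.
Qed.

(* Without constraint qualification: Farkas' lemma in the product of one copy
   of [V] per piece yields a common vector in all the normal cones; the
   alternative is a direction of descent obtained by convexity. *)
Lemma subgradient_exists W n (C : 'I_n -> seq (V * R)) (v : 'I_n -> V)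
    (k : 'I_n -> V -> R) z g (h : V -> R) D F :
  convex_on D F -> D z ->
  (forall j, polyh (C j) z) -> (forall j x, polyh (C j) x -> D x) ->
  (forall j d t, polyh (C j) (z + t *: d) ->
     F (z + t *: d) = F z + t * inner (v j) d + t ^+ 2 * k j d) ->
  (forall y, D y -> exists j t, 0 < t <= 1 /\ polyh (C j) (z + t *: (y - z))) ->
  (forall d t, d \in W -> D (z + t *: d) ->
     F z <= F (z + t *: d) - t * inner g d + t ^+ 2 * h d) ->
  exists2 w, w - g \in ocompl W & forall y, D y -> F z + inner w (y - z) <= F y.
Proof.
move=> Fconv Dz Cz CD Fexp Dloc zmin.
pose VV := hprod (fun _ : 'I_n => V).
pose inj j x : VV := @hpinj R n (fun=> V) j x.
have innerj j x (d : VV) : inner d (inj j x) = inner (d j) x.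
  by rewrite innerC inner_hpinj innerC.
pose diag x : VV := hpmk (fun=> x).
have diag_lin : linear diag by move=> a x y; apply/hprodP => j; rewrite hpP !hpmkE.
pose diagL := HB.pack_for {linear V -> VV} diag
  (GRing.isLinear.Build R V VV *:%R diag diag_lin).
(* The tuples orthogonal to [U] are those whose sum lies in [W]. *)
pose U := (linfun diagL @: ocompl W)%VS.
pose s := flatten [seq [seq inj j a | a <- active (C j) z] | j <- enum 'I_n].
pose b : VV := hpmk (fun j => g - v j).
have sP (d : VV) : (forall j a, a \in active (C j) z -> inner (d j) a <= 0) <->
    (forall a, a \in s -> inner d a <= 0).
  split=> [dj a /flatten_mapP[j _ /mapP[c cj ->]]|ds j a aj].
    by rewrite innerj dj.
  by rewrite -innerj ds //; apply/flatten_mapP; exists j; rewrite ?mem_enum ?map_f.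
case: (farkas U s b) => [[_ /memv_imgP[e eW ->] eP]|[d [dU /sP ds db]]].
  (* For every [j], [g - e - v j] lies in the normal cone of the [j]-th piece at [z]. *)
  exists (g - e) => [|y Dy]; first by rewrite addrAC subrr add0r rpredN.
  have [j [t [/andP[t0 t1] jt]]] := Dloc y Dy.
  have jv : inner (v j) (y - z) >= inner (g - e) (y - z).
    have := eP (inj j (t *: (y - z))); rewrite innerC innerj lfunE /= !(hpD,hpN,hpmkE).
    rewrite innerZr pmulr_rle0 // => eP'; rewrite -subr_le0 -innerNl -innerDl.
    rewrite addrAC; apply: eP'; apply/sP => i a.
    have [<-|ji] := eqVneq j i; last by rewrite /inj hpinj_out // inner0l.
    rewrite /inj hpinj_in => aj.
    by have := @active_le0 (C j) z _ a jt; rewrite addrC addKr => /(_ aj).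
  suff : 0 <= F y - F z - inner (g - e) (y - z) by lra.
  (* Convexity between [z] and [y] is compared with the expansion on piece [j]: [t] keeps the point
     in that piece, 1/2 keeps the weight below 1. *)
  apply: (@second_order_ge0 _ _ (- k j (y - z)) (Num.min t (1/2))).
    by rewrite lt_min t0 divr_gt0.
  move=> r /andP[r0]; rewrite le_min => /andP[rt r1].
  have [|_] := Fconv y z r Dy Dz; first by rewrite r0; lra.
  have -> : r *: y + (1 - r) *: z = z + r *: (y - z).
    by rewrite scalerBl scale1r scalerBr addrCA.
  rewrite (Fexp j); last by apply: polyh_segment jt _; rewrite // ltW.
  by have := ler_wpM2l (ltW r0) jv; lra.
have dsum : \sum_j d j \in W.
  rewrite -[W]ocomplK; apply/ocomplP => e eW.
  have /ocomplP/(_ (diag e)) := dU; rewrite hprod_innerE inner_suml.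
  under eq_bigr do rewrite hpmkE.
  by apply; apply/memv_imgP; exists e; rewrite ?lfunE.
(* Each [d j] is feasible for its own piece; the slopes add up along the sum, where minimality of
   [z] contradicts [db]. *)
have [e [K [e0 eK]]] : slope_le D F z (\sum_j d j) (\sum_j inner (v j) (d j)).
  apply: (big_ind2 (slope_le D F z)) => [|x1 x2 y1 y2|j _]; first exact: slope_le0.
    exact: slope_leD.
  have [|e e0 eP] := @active_feasible (C j) z (d j) (Cz j); first exact: ds.
  exists e, (k j (d j)); split=> // t /eP jt.
  by split; [exact: CD jt | rewrite (Fexp j)].
have ge0 : 0 <= \sum_j inner (v j) (d j) - inner g (\sum_j d j).
  apply: (@second_order_ge0 _ _ (K + h (\sum_j d j)) e e0) => t /andP[t0 te].
  have [|Dt Ft] := eK t; first by rewrite te ltW.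
  by have := zmin _ _ dsum Dt; lra.
exfalso; move: ge0; rewrite leNgt => /negP; apply; rewrite -opprB oppr_lt0; move: db.
rewrite hprod_innerE innerC inner_suml -sumrB; congr (0 < _).
by apply: eq_bigr => j _; rewrite hpmkE innerDr innerNr !(innerC (d j)).
Qed.

End KKT.

(** * Optimality conditions for piecewise quadratic convex functions *)

Section PiecewiseQuadratic.
Variables (R : realType) (V : finHilbertType R).
Implicit Types (x y z d w : V) (s : seq (V * R)) (W : {vspace V}).
Implicit Types (D : set V) (F : V -> R).

(** An arbitrary finite index type lets the pieces of a product be indexed by dependent
    functions. *)
Definition plq_on D F := exists (I : finType) (C : I -> seq (V * R)) (q : I -> V -> R),
  [/\ forall k, quadratic (q k), forall x, D x <-> exists k, polyh (C k) x
    & forall k x, polyh (C k) x -> F x = q k x].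

Lemma polyh_leave s z d : ~ polyh s z ->
  exists2 e : R, 0 < e & forall t, 0 <= t <= e -> ~ polyh s (z + t *: d).
Proof.
move=> /existsNP[p /not_implyP[ps /negP]]; rewrite -ltNge => pz.
exists ((inner p.1 z - p.2) / (2 * (`|inner p.1 d| + 1))) => [|t].
  by rewrite divr_gt0 ?subr_gt0 // mulr_gt0 // ltr_wpDl.
rewrite ler_pdivlMr ?mulr_gt0 ?ltr_wpDl // => /andP[t0 te] /(_ p ps).
have := lerNnormlW (lexx `|t * inner p.1 d|).
rewrite !inner_lin normrM (ger0_norm t0).
by move: (`|inner p.1 d|) te => k te; nra.
Qed.

Lemma uniform_radius (I : eqType) (r : seq I) (P : I -> R -> Prop) :
  (forall k, k \in r -> exists2 e : R, 0 < e & forall t, 0 <= t <= e -> P k t) ->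
  exists2 e : R, 0 < e & forall k t, k \in r -> 0 <= t <= e -> P k t.
Proof.
elim: r => [_|k r IHr rP]; first by exists 1.
have [|e e0 eP] := IHr; first by move=> l lr; apply: rP; rewrite inE lr orbT.
have [e' e'0 e'P] := rP k (mem_head _ _).
exists (Num.min e e') => [|l t]; first by rewrite lt_min e0.
rewrite inE le_min => + /and3P[t0 te te'].
by move=> /predU1P[->|lr]; [apply: e'P | apply: eP]; rewrite // t0.
Qed.

Theorem plq_kkt W D F (T : 'End(V)) (b : V) (q0 : V -> R) :
  plq_on D F -> convex_on D F -> selfadjoint T -> expands T b q0 ->
  (exists m, forall x, x \in W -> D x -> m <= F x + q0 x) ->
  (exists2 x, x \in W & D x) ->
  exists z w, [/\ z \in W, D z, forall y, D y -> F z + inner w (y - z) <= F y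
                & w + (T z + b) \in ocompl W].
Proof.
move=> [I [C [q [qq DC Fq]]]] Fconv Tsym q0E [m qm] [x0 x0W Dx0].
have /choice[Tb TbP] : forall k, exists Tb : 'End(V) * V,
    selfadjoint Tb.1 /\ expands Tb.1 Tb.2 (q k).
  by move=> k; have [Tk [bk ?]] := quadratic_expands (qq k); exists (Tk, bk).
have [z [zW Dz] zmin] : exists2 z, z \in W /\ D z &
    forall y, y \in W /\ D y -> F z + q0 z <= F y + q0 y.
  pose P k := [set x | x - 0 \in W /\ polyh (C k) x].
  have PC k : attains (P k) (fun x => F x + q0 x).
    apply: (@attains_ext _ _ _ (fun x => q k x + q0 x)) => [x [_ /Fq->]//|].
    have [Tksym qkE] := TbP k; apply: (frank_wolfe _ (expandsD qkE q0E)).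
      by move=> x y; rewrite !lfunE /= !inner_lin Tksym Tsym.
    exists m => x; rewrite subr0 => xW kx; rewrite -(Fq k) //.
    by apply: qm => //; apply/DC; exists k.
  have := attains_bigcup (s := enum I) (fun k _ => PC k).
  case=> [|z [k _ [zW kz]] zmin].
    have /DC[k kx] := Dx0; exists x0, k; first by rewrite mem_enum.
    by split=> //; rewrite subr0.
  exists z => [|y [yW /DC[l ly]]].
    by split; [rewrite -[z]subr0 | apply/DC; exists k].
  by apply: zmin; exists l; [rewrite mem_enum | split; rewrite ?subr0].
(* Only the pieces through [z] determine [F] near [z], in the sense of short steps towards points of
   [D]. *)
pose A := [pred k | `[< polyh (C k) z >]].
have AP (j : 'I_#|A|) : polyh (C (enum_val j)) z by apply/asboolP/(enum_valP j).
have [||||w wW wP] := @subgradient_exists R V W #|A| (fun j => C (enum_val j))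
  (fun j => (Tb (enum_val j)).1 z + (Tb (enum_val j)).2)
  (fun j d => inner ((Tb (enum_val j)).1 d) d / 2)
  z (- (T z + b)) (fun d => inner (T d) d / 2) D F Fconv Dz AP.
- by move=> j x jx; apply/DC; exists (enum_val j).
- move=> j d t jt; rewrite (Fq _ _ jt) (Fq _ _ (AP j)).
  by have [_ ->] := TbP (enum_val j).
(* A common step length for which the segment towards [y] meets no piece missing [z]; by convexity
   the point stays in [D], hence in a piece through [z]. *)
- move=> y Dy; have [|e e0 eP] := @uniform_radius I (enum I)
    (fun k t => ~ polyh (C k) z -> ~ polyh (C k) (z + t *: (y - z))).
    move=> k _; have [kz|/(polyh_leave (y - z))[e e0 eP]] := pselect (polyh (C k) z).
      by exists 1.
    by exists e => // t te _; exact: eP.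
  pose t := Num.min e (1 / 2).
  have t0 : 0 < t by rewrite lt_min e0 divr_gt0.
  have t1 : t < 1 by rewrite gt_min; apply/orP; right; lra.
  have [|/DC[k]] := Fconv y z t Dy Dz; first by rewrite t0.
  have -> : t *: y + (1 - t) *: z = z + t *: (y - z).
    by rewrite scalerBl scale1r scalerBr addrCA.
  move=> kt; have kA : k \in A.
    apply/asboolP; apply: contrapT => kz.
    apply: (eP k t) kz kt; first by rewrite mem_enum.
    by rewrite (ltW t0) ge_min lexx.
  exists (enum_rank_in kA k), t; rewrite enum_rankK_in // t0 ltW //.
- move=> d t dW Dt; have := zmin (z + t *: d).
  by rewrite memvD ?memvZ // q0E innerNl => /(_ (conj isT Dt)); lra.
exists z, w; split=> //; by rewrite opprK in wW.
Qed.

End PiecewiseQuadratic.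

(** * Separable sums of piecewise quadratic functions *)

Section SeparableSum.
Variables (R : realType) (m : nat) (X : 'I_m -> finHilbertType R).

Lemma plq_on_prod (D : forall i, set (X i)) (F : forall i, X i -> R) :
  (forall i, plq_on (D i) (F i)) ->
  plq_on [set x : hprod X | forall i : 'I_m, D i (x i)]
         (fun x : hprod X => \sum_i F i (x i)).
Proof.
move=> DF.
(* The data are chosen as a sigma type because the types of [C] and [q] depend on the chosen index
   type. *)
have H i : {I : finType & {C : I -> seq (X i * R) & {q : I -> X i -> R |
    [/\ forall k, quadratic (q k), forall x, D i x <-> exists k, polyh (C k) x
      & forall k x, polyh (C k) x -> F i x = q k x]}}}.
  by have /cid[I /cid[C /cid[q H]]] := DF i; exists I, C, q.
pose I i := projT1 (H i); pose C i : I i -> _ := projT1 (projT2 (H i)).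
pose q i : I i -> _ := projT1 (projT2 (projT2 (H i))).
have qq i k : quadratic (q i k).
  by have [+ _ _] := projT2 (projT2 (projT2 (H i))); apply.
have DC i x : D i x <-> exists k, polyh (C i k) x.
  by have [_ + _] := projT2 (projT2 (projT2 (H i))); apply.
have Fq i k x : polyh (C i k) x -> F i x = q i k x.
  by have [_ _] := projT2 (projT2 (projT2 (H i))); apply.
(* A piece of the product is a product of pieces, one chosen by [kk] in each factor; its quadratic
   is block diagonal. *)
exists {dffun forall i, I i}, (fun kk : {dffun forall i, I i} => flatten
  [seq [seq (hpinj p.1, p.2) | p <- C i (kk i)] | i <- enum 'I_m]),
  (fun (kk : {dffun forall i, I i}) (x : hprod X) => \sum_i q i (kk i) (x i)).
have polyhE (kk : {dffun forall i, I i}) (x : hprod X) : polyh (flatten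
    [seq [seq (hpinj p.1, p.2) | p <- C i (kk i)] | i <- enum 'I_m]) x <->
    forall i : 'I_m, polyh (C i (kk i)) (x i).
  split=> [kx i p pC|kx _ /flatten_mapP[i _ /mapP[p pC ->]]].
    rewrite -inner_hpinj; apply: (kx (hpinj p.1, p.2)).
    by apply/flatten_mapP; exists i; rewrite ?mem_enum //; apply/mapP; exists p.
  by have := kx i p pC; rewrite -inner_hpinj.
split=> [kk|x|kk x /polyhE kx].
- have Qbc i : {Q : 'End(X i) & {b : X i & {c | forall x,
      q i (kk i) x = inner (Q x) x + inner b x + c}}}.
    by have /cid[Q /cid[b /cid[c H']]] := qq i (kk i); exists Q, b, c.
  pose Q i := projT1 (Qbc i); pose b i := projT1 (projT2 (Qbc i)).
  pose f (x : hprod X) : hprod X := hpmk (fun i => Q i (x i)).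
  have flin : linear f.
    move=> a x y; apply/hprodP => i.
    by rewrite hpP ![f _ _]hpmkE hpP linearP.
  pose g := HB.pack_for {linear hprod X -> hprod X} f
    (GRing.isLinear.Build R (hprod X) (hprod X) *:%R f flin).
  exists (linfun g), (hpmk b), (\sum_i projT1 (projT2 (projT2 (Qbc i)))) => x.
  have -> : linfun g x = f x by exact: (lfunE g x).
  rewrite !hprod_innerE -!big_split /=; apply: eq_bigr => i _.
  by rewrite /f !hpmkE; exact: (projT2 (projT2 (projT2 (Qbc i))) (x i)).
- split=> [Dx|[kk /polyhE kx] i]; last by apply/DC; exists (kk i).
  have k i : {k | polyh (C i k) (x i)} by apply/cid/DC.
  by exists [ffun i => projT1 (k i)]; apply/polyhE => i; rewrite ffunE; case: (k i).
- by apply: eq_bigr => i _; exact: Fq.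
Qed.

Lemma convex_on_prod (D : forall i, set (X i)) (F : forall i, X i -> R) :
  (forall i, convex_on (D i) (F i)) ->
  convex_on [set x : hprod X | forall i : 'I_m, D i (x i)]
            (fun x : hprod X => \sum_i F i (x i)).
Proof.
move=> DF x y t Dx Dy t01; split=> [i|].
  by rewrite hpD !hpZ; case: (DF i (x i) (y i) t).
rewrite !mulr_sumr -big_split /=; apply: ler_sum => i _.
by rewrite hpD !hpZ; case: (DF i (x i) (y i) t).
Qed.

End SeparableSum.

(** * Passage from extended-real functions to real functions on their domains *)

Section ExtendedReal.
Variables (R : realType) (V : finHilbertType R).
Implicit Types f : V -> \bar R.

Lemma proper_edomE f x : proper_fun f -> edom f x -> f x = (fine (f x))%:E.
Proof.
move=> [fN _] fx; rewrite fineK // fin_numE fN /=.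
by move: fx; rewrite /edom /= lt_neqAle => /andP[].
Qed.

Lemma proper_notin_edom f x : ~ edom f x -> f x = +oo%E.
Proof. by move=> /negP; rewrite -leNgt leye_eq => /eqP. Qed.

Lemma plq_on_edom f : piecewise_linquad f -> plq_on (edom f) (fine \o f).
Proof.
move=> [n [C [q [Cq fC fq]]]].
have /choice[s sP] k : exists s : seq (V * R), C k = polyh s by case: (Cq k).
exists 'I_n, s, q; split=> [k|x|k x]; first by case: (Cq k).
- rewrite fC; split=> [[k _]|[k sx]]; first by rewrite sP; exists k.
  by exists k; rewrite ?sP.
- by rewrite -sP /= => /fq ->.
Qed.

Lemma convex_on_edom f : proper_fun f -> convex_fun f ->
  convex_on (edom f) (fine \o f).
Proof.
move=> fp fc x y t fx fy /andP[t0 t1]; have := fc x y t t0 t1.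
rewrite (proper_edomE fp fx) (proper_edomE fp fy) -!EFinM -EFinD => ft.
have ftD : edom f (t *: x + (1 - t) *: y) by rewrite /edom /= (le_lt_trans ft) ?ltry.
by split=> //; rewrite /= -lee_fin -(proper_edomE fp ftD).
Qed.

Lemma subdiff_monotone f : monotone (subdiff f).
Proof.
move=> x y u v [/fineK fx xu] [/fineK fy yv].
have := xu y; have := yv x; rewrite -fx -fy -!EFinD !lee_fin.
by rewrite !inner_lin !(innerC _ u) !(innerC _ v); lra.
Qed.

End ExtendedReal.

(** * Subgradients of separable sums *)

Section SubdiffSepsum.
Variables (R : realType) (m : nat) (X : 'I_m -> finHilbertType R).
Variable phi : forall i, X i -> \bar R.
Arguments phi : clear implicits.
Hypothesis phi_proper : forall i, proper_fun (phi i).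
Implicit Types x y z w : hprod X.

Let D := [set x : hprod X | forall i : 'I_m, edom (phi i) (x i)].
Let F x := \sum_i (fine \o phi i) (x i).

Lemma sepsumE x : D x -> sepsum phi x = (F x)%:E.
Proof.
move=> Dx; rewrite /sepsum /F -sumEFin; apply: eq_bigr => i _.
exact: proper_edomE.
Qed.

Lemma sepsum_notin x : ~ D x -> sepsum phi x = +oo%E.
Proof.
move=> /existsNP[i /proper_notin_edom phiy].
apply/esum_eqyP; first by move=> j _; case: (phi_proper j).
by exists i; rewrite mem_index_enum.
Qed.

Lemma subdiff_sepsum z w : D z ->
  (forall y, D y -> F z + inner w (y - z) <= F y) -> subdiff (sepsum phi) z w.
Proof.
move=> Dz wP; rewrite /subdiff /= sepsumE //; split=> // y.
have [Dy|Dy] := pselect (D y); last by rewrite sepsum_notin // leey.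
by rewrite sepsumE // -EFinD lee_fin wP.
Qed.

Lemma subdiff_sum_le x w : (forall i : 'I_m, subdiff (phi i) (x i) (w i)) ->
  D x /\ forall y, D y -> F x + inner w (y - x) <= F y.
Proof.
move=> xw; have Dx : D x by move=> i; have [/fin_numPlt/andP[]] := xw i.
split=> // y Dy; rewrite hprod_innerE -big_split; apply: ler_sum => i _ /=.
have [_ /(_ (y i))] := xw i; rewrite hpD hpN -lee_fin EFinD.
by rewrite -!proper_edomE.
Qed.

End SubdiffSepsum.

(** * Operators on a subspace, extended to the whole space *)

Section Lift.
Variables (R : realType) (V : finHilbertType R) (U : {vspace V}).
Implicit Types (x y : V) (T : 'End(subvs_of U)).

(** Extension by zero on the orthogonal complement of [U]; both metrics thus become positive
    semidefinite operators on the same space. *)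
Definition lift_op T : 'End(V) := linfun (vsval \o T \o vsproj U \o oproj U).

Lemma lift_opE T x : lift_op T x = vsval (T (vsproj U (oproj U x))).
Proof. by rewrite lfunE. Qed.

Lemma lift_op_in T x : lift_op T x \in U.
Proof. by rewrite lift_opE subvsP. Qed.

Lemma lift_op_oproj T x y : oproj U x = oproj U y -> lift_op T x = lift_op T y.
Proof. by rewrite !lift_opE => ->. Qed.

Lemma lift_op_comp T T' x : lift_op T (lift_op T' x) = lift_op (T \o T')%VF x.
Proof.
rewrite [LHS]lift_opE oproj_id ?lift_op_in // !lift_opE comp_lfunE.
by rewrite vsvalK.
Qed.

Lemma lift_op1 x : lift_op \1%VF x = oproj U x.
Proof. by rewrite lift_opE id_lfunE vsprojK ?oproj_in. Qed.

Lemma lift_op_inner T x y : inner (lift_op T x) y =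
  inner (T (vsproj U (oproj U x))) (vsproj U (oproj U y)).
Proof.
rewrite -(oproj_id (lift_op_in T x)) oproj_sym lift_opE.
by rewrite subvs_innerE [in RHS]vsprojK ?oproj_in.
Qed.

Lemma lift_op_selfadjoint T : selfadjoint T -> selfadjoint (lift_op T).
Proof.
by move=> Tsym x y; rewrite lift_op_inner Tsym [RHS]innerC lift_op_inner innerC.
Qed.

Lemma lift_op_ge0 T x : posdef T -> 0 <= inner (lift_op T x) x.
Proof.
move=> Tpos; rewrite lift_op_inner; move: (vsproj _ _) => v.
by have [->|/Tpos/ltW//] := eqVneq v 0; rewrite inner0r.
Qed.

(** Makes [T^-1] a two-sided inverse, so that the lifts of [T] and [T^-1] compose to the projection
    onto [U]. *)
Lemma posdef_lker0 T : posdef T -> lker T == 0%VS.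
Proof.
move=> Tpos; rewrite -subv0; apply/subvP => x; rewrite memv_ker memv0 => /eqP Tx.
by apply: contraT => /Tpos; rewrite Tx inner0l ltxx.
Qed.

End Lift.

(** * Partial inverses, projected mappings and the decoupling step *)

Section DecouplingTheory.
Variables (R : realType) (V : finHilbertType R) (S0 S S1 : {vspace V}).
Hypotheses (S0S : (S0 <= S)%VS) (SS1 : (S <= S1)%VS).
Implicit Types (A M : V -> set V) (x y z w : V).

(** Exchanging the components in the complement of [S] between argument and value leaves
    [inner dz dw] unchanged. *)
Lemma partial_inverse_monotone M : monotone M -> monotone (partial_inverse S M).
Proof.
move=> Mmon x y u v [z [w [zw -> ->]]] [z' [w' [zw' -> ->]]].
have := Mmon _ _ _ _ zw zw'; set dz := z - z'; set dw := w - w' => dzw.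
have -> : oproj S z + oproj (ocompl S) w - (oproj S z' + oproj (ocompl S) w') =
    oproj S dz + oproj (ocompl S) dw by rewrite opprD addrACA -!linearB.
have -> : oproj S w + oproj (ocompl S) z - (oproj S w' + oproj (ocompl S) z') =
    oproj S dw + oproj (ocompl S) dz by rewrite opprD addrACA -!linearB.
have dE U p r : inner (oproj U p + oproj (ocompl U) r) (oproj U dw) =
    inner (oproj U p) (oproj U dw).
  rewrite innerDl [X in _ + X]innerC.
  by rewrite (inner_orth (oproj_in U _) (oproj_in _ _)) addr0.
move: dzw; rewrite -{1}(oproj_add S dz) -{1}(oproj_add S dw).
rewrite !innerDl !innerDr.
have orth p r : inner (oproj S p) (oproj (ocompl S) r) = 0.
  exact: inner_orth (oproj_in _ _) (oproj_in _ _).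
rewrite !orth ![inner (oproj (ocompl S) _) (oproj S _)]innerC !orth.
by rewrite !addr0 !add0r [inner (oproj (ocompl S) dw) _]innerC.
Qed.

Lemma Hstarstar_orth : (Hstarstar S0 S S1 <= ocompl (Hstar S0 S1))%VS.
Proof.
have S1C := ocomplS SS1; have SC := ocomplS S0S.
apply/subvP => _ /memv_addP[k0 + [k1 + ->]].
rewrite !memv_cap => /andP[k0S k00] /andP[k1S k11].
apply/ocomplP => _ /memv_addP[a aS0 [b bS1 ->]].
have k1C := subvP SC _ k1S; have bC := subvP S1C _ bS1.
rewrite !innerDl !innerDr (inner_orth k0S bC) (inner_orth k11 bS1).
by rewrite !(innerC _ a) (inner_orth aS0 k00) (inner_orth aS0 k1C) !addr0.
Qed.

(** Splitting [x] along [S] and its complement leaves one remainder in each summand of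
    [Hstarstar]. *)
Lemma oproj_Hstarstar x :
  x - (oproj S0 x + oproj (ocompl S1) x) \in Hstarstar S0 S S1.
Proof.
have -> : x - (oproj S0 x + oproj (ocompl S1) x) =
    (oproj S x - oproj S0 x) + (oproj (ocompl S) x - oproj (ocompl S1) x).
  by rewrite addrACA oproj_add opprD.
apply: memv_add; rewrite memv_cap.
  rewrite memvB ?oproj_in ?(subvP S0S) ?oproj_in //=.
  by rewrite -(oproj_oproj x S0S) oproj_orth.
rewrite memvB ?oproj_in ?(subvP (ocomplS SS1)) ?oproj_in //=.
have := oproj_orth (ocompl S1) (oproj (ocompl S) x).
by rewrite ocomplK oproj_oproj ?ocomplS.
Qed.

Lemma oproj_Hstar x :
  oproj (Hstar S0 S1) x = oproj S0 x + oproj (ocompl S1) x.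
Proof.
apply: oproj_uniq; first by rewrite memv_add ?oproj_in.
exact: (subvP Hstarstar_orth _ (oproj_Hstarstar x)).
Qed.

Lemma projected_monotone A : monotone A -> monotone (projected_map S0 S S1 A).
Proof.
move=> Amon x y u v [x' Ax] [y' Ay]; have := Amon _ _ _ _ Ax Ay.
have -> : inner (x - y) (u - v) = inner (vsval (x - y)) (vsval (u - v)) by [].
rewrite opprD addrACA -!(linearB vsval) innerDl [X in _ + X]innerC.
rewrite (inner_orth (subvsP (u - v)) (subvP Hstarstar_orth _ (subvsP (x' - y')))).
by rewrite addr0.
Qed.

Lemma step_opE (As : 'End(subvs_of S0)) (Cs : 'End(subvs_of (ocompl S1))) x :
  step_op As Cs x = lift_op As x + lift_op (Cs^-1)%VF x.
Proof. by rewrite !lift_opE. Qed.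

(* Minty: the step with identity metrics is the resolvent of the projected
   mapping. *)
Lemma projected_maximal A : monotone A -> implementable S0 S1 A ->
  maximal_monotone (projected_map S0 S S1 A).
Proof.
move=> Amon Aimp; split=> [|M Mmon AM]; first exact: projected_monotone.
have posdef1 (U : {vspace V}) : posdef (\1%VF : 'End(subvs_of U)).
  by move=> x x0; rewrite id_lfunE inner_gt0.
have self1 (U : {vspace V}) : selfadjoint (\1%VF : 'End(subvs_of U)).
  by move=> x y; rewrite !id_lfunE.
have res (x : subvs_of (Hstar S0 S1)) :
    exists p, projected_map S0 S S1 A p (x - p).
  have [xp [u Au]] := Aimp 1 \1%VF \1%VF ltr01 (self1 _) (posdef1 _)
    (self1 _) (posdef1 _) (vsval x).
  have inv1 : (\1^-1 = \1 :> 'End(subvs_of (ocompl S1)))%VF.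
    by rewrite -[LHS]comp_lfun1r lker0_compVf // posdef_lker0.
  rewrite step_opE inv1 !lift_op1 -oproj_Hstar invr1 scale1r linearB /=.
  rewrite (oproj_id (subvsP x)) => uE.
  exists (vsproj (Hstar S0 S1) (oproj (Hstar S0 S1) xp)).
  exists (vsproj (Hstarstar S0 S S1) (xp - oproj (Hstar S0 S1) xp)).
  rewrite (linearB vsval) /= !vsprojK ?oproj_in //; last first.
    by rewrite oproj_Hstar oproj_Hstarstar.
  move/eqP: uE; rewrite addr_eq0 opprB => /eqP uE.
  by rewrite addrC subrK -uE.
apply/funext => a; apply/seteqP; split=> [b|]; last exact: AM.
(* Monotonicity against the resolvent point of [a + b] gives [- inner (a - p) (a - p) >= 0], hence
   [a = p]. *)
move=> Mab; have [p pP] := res (a + b).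
have := Mmon _ _ _ _ Mab (AM _ _ pP).
have -> : b - (a + b - p) = - (a - p) by rewrite !opprB addrCA opprD [b + _]addrCA subrr addr0.
rewrite innerNr oppr_ge0 => /inner_eq0/eqP; rewrite subr_eq0 => /eqP ap.
by move: pP; rewrite -ap addrAC subrr add0r.
Qed.

Lemma oproj_sum x : x \in (S + ocompl S1)%VS ->
  oproj (ocompl S) x = oproj (ocompl S1) x.
Proof.
move=> /memv_addP[s sS [r rS1 ->]]; rewrite !linearD /=.
rewrite (oproj_id rS1) (oproj_id (subvP (ocomplS SS1) _ rS1)).
by rewrite !oproj_ortho0 ?ocomplK // (subvP SS1).
Qed.

Lemma selfadjoint_expands (T : 'End(V)) b : selfadjoint T ->
  expands T b (fun x => inner (T x) x / 2 + inner b x).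
Proof.
move=> Tsym x d t.
have -> : T (x + t *: d) = T x + t *: T d by rewrite linearD linearZ.
rewrite !inner_lin.
by rewrite (Tsym d x) (innerC d (T x)); field.
Qed.

(** Up to a constant, the objective is [F y + <A(y - x), y - x> / (2c) + c <C y, y> / 2 - <P x, y>]
    over [y] in [S + ocompl S1]. The components of its optimality condition in [S] and in
    [ocompl S1] are those of the step inclusion. *)
Theorem plq_implementable (D : set V) (F : V -> R) M xs ws :
  plq_on D F -> convex_on D F ->
  (forall z w, D z -> (forall y, D y -> F z + inner w (y - z) <= F y) -> M z w) ->
  D xs -> (forall y, D y -> F xs + inner ws (y - xs) <= F y) ->
  xs \in S -> ws \in ocompl S ->
  implementable S0 S1 (partial_inverse S M).
Proof.
move=> DF Fconv FM Dxs Fxs xsS wsS c As Cs c0 Asym Apos Csym Cpos x.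
pose a := lift_op As; pose C := lift_op Cs; pose P := oproj (ocompl S1).
pose Ci := lift_op (Cs^-1)%VF.
have CCi y : C (Ci y) = P y.
  by rewrite lift_op_comp lker0_compfV ?posdef_lker0 // lift_op1.
have CiC y : Ci (C y) = P y.
  by rewrite lift_op_comp lker0_compVf ?posdef_lker0 // lift_op1.
have asym := lift_op_selfadjoint Asym; have Csym' := lift_op_selfadjoint Csym.
pose T := c^-1 *: a + c *: C; pose b := - (c^-1 *: a x) - P x.
have TE y : T y = c^-1 *: a y + c *: C y by rewrite add_lfunE !scale_lfunE.
have Tsym : selfadjoint T.
  by move=> y z; rewrite !TE !inner_lin asym Csym'.
have ci0 : 0 < c^-1 by rewrite invr_gt0.
have [||z [w [zW Dz zw we]]] :=
    plq_kkt (W := (S + ocompl S1)%VS) DF Fconv Tsym (selfadjoint_expands b Tsym).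
(* With this [k], the subgradient [ws] and the term in [P x] combine to [inner (C k) y]; completing
   the squares in both metrics gives the lower bound. *)
- pose k := Ci (ws - x).
  exists (F xs - c^-1 / 2 * inner (a x) x - c^-1 / 2 * inner (C k) k) => y yW Dy.
  have Fy : F xs + inner ws (P y) <= F y.
    have := Fxs y Dy; rewrite innerDr innerNr [inner ws xs]innerC.
    rewrite (inner_orth xsS wsS) subr0 -{1}(oproj_add S y) innerDr.
    by rewrite [inner ws _]innerC (inner_orth (oproj_in S y) wsS) add0r oproj_sum.
  have ax : 0 <= inner (a (y - x)) (y - x) by exact: lift_op_ge0.
  have Ck : 0 <= inner (C (y + c^-1 *: k)) (y + c^-1 *: k).
    exact: lift_op_ge0.
  have CkE : inner (C k) y = inner ws (P y) - inner (P x) y.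
    by rewrite CCi linearB /= -/P -!oproj_sym innerDl innerNl.
  rewrite (_ : a (y - x) = a y - a x) in ax; last by rewrite linearB.
  rewrite (_ : C (y + c^-1 *: k) = C y + c^-1 *: C k) in Ck; last first.
    by rewrite linearD linearZ.
  move: ax Ck; rewrite TE /b !inner_lin.
  rewrite (asym y x) (innerC y) (Csym' y k) (innerC y) CkE => ax Ck.
  have := ler_wpM2l (ltW ci0) ax; have := ler_wpM2l (ltW c0) Ck.
  rewrite !mulr0 !mulrDr !mulrA !divff ?gt_eqF // !mul1r.
  by lra.
- by exists xs; rewrite // (subvP (addvSl _ _)).
have aS y : a y \in S by rewrite (subvP S0S) ?lift_op_in.
have CS1 y : C y \in ocompl S1 by exact: lift_op_in.
have S1C := subvP (ocomplS SS1).
have wS : oproj S w = c^-1 *: (a x - a z).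
  have : oproj S (w + (T z + b)) = 0.
    by apply: oproj_ortho0; apply: (subvP (ocomplS (addvSl _ _))) we.
  rewrite TE /b !linearD !linearN !linearZ /= !(oproj_id (aS _)).
  rewrite (oproj_ortho0 (S1C _ (CS1 z))) (oproj_ortho0 (S1C _ (oproj_in _ x))).
  rewrite scaler0 addr0 oppr0 addr0 => /eqP; rewrite addr_eq0 => /eqP ->.
  by rewrite opprD scalerN opprK addrC scalerN.
have wS1 : P w - P x = - c *: C z.
  have : P (w + (T z + b)) = 0.
    by apply: oproj_ortho0; apply: (subvP (ocomplS (addvSr _ _))) we.
  have aP y : P (a y) = 0.
    by apply: oproj_ortho0; rewrite ocomplK (subvP SS1).
  rewrite TE /b !linearD !linearN !linearZ /= !aP oppr0 !scaler0 !add0r.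
  rewrite [P (C z)]oproj_id // [P (P x)]oproj_id ?oproj_in // addrCA => /eqP.
  by rewrite addrC addr_eq0 => /eqP ->; rewrite scaleNr.
(* The partial inverse of the pair [(z, w)]; [wS] and [wS1] are the two components of the inclusion,
   and [zW] places the component of [z] orthogonal to [S] in [ocompl S1]. *)
exists (oproj S z + oproj (ocompl S) w).
exists (oproj S w + oproj (ocompl S) z); first by exists z, w; split=> //; exact: FM.
rewrite step_opE -/a -/Ci !linearB /=.
have -> : a (oproj S z + oproj (ocompl S) w) = a z.
  apply: lift_op_oproj; rewrite linearD /= oproj_oproj // [X in _ + X]oproj_ortho0.
    by rewrite addr0.
  by apply: (subvP (ocomplS S0S)); exact: oproj_in.
have -> : Ci (oproj S z + oproj (ocompl S) w) = Ci (P w).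
  apply: lift_op_oproj; rewrite linearD /= [X in X + _]oproj_ortho0.
    by rewrite add0r oproj_oproj ?ocomplS // [RHS]oproj_id ?oproj_in.
  by rewrite ocomplK (subvP SS1) ?oproj_in.
have -> : Ci x = Ci (P x).
  by apply: lift_op_oproj; rewrite [RHS]oproj_id ?oproj_in.
rewrite -(linearB Ci) wS1 linearZ /= CiC wS oproj_sum // -/P.
rewrite [X in _ + X]scalerDr scalerA mulrN mulVf ?gt_eqF // scaleN1r addrACA -scalerDr.
by rewrite subrKA !subrr scaler0 addr0.
Qed.

End DecouplingTheory.

Local Close Scope classical_set_scope.

Theorem corollary5p4 (R : realType) (m : nat) (X : 'I_m -> finHilbertType R)
    (Y : finHilbertType R) (L : forall i, 'Hom(X i, Y))
    (phi : forall i, X i -> \bar R)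
    (S := lker (sumlfun L)) (M := subdiff (sepsum phi)) :
  (forall i, [/\ closed_fun (phi i), proper_fun (phi i), convex_fun (phi i)
               & piecewise_linquad (phi i)]) ->
  (exists (x : hprod X) (y : Y), sumlfun L x = 0 /\
     forall i, subdiff (phi i) (x i) (- adjoint (L i) y)) ->
  forall S0 S1 : {vspace hprod X}, (S0 <= S)%VS -> (S <= S1)%VS ->
    maximal_monotone (projected_map S0 S S1 (partial_inverse S M))
    /\ implementable S0 S1 (partial_inverse S M).
Proof.
move=> phiP [x [y [Lx xy]]] S0 S1 S0S SS1.
have phi_proper i : proper_fun (phi i) by case: (phiP i).
(* The vector [- L^* y]: a subgradient of the sum at [x], orthogonal to the kernel of [L]. *)
pose w : hprod X := hpmk (fun i => - adjoint (L i) y).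
have [Dx Fx] : _ /\ _ := subdiff_sum_le phi_proper (x := x) (w := w)
  (fun i => eq_ind_r (subdiff (phi i) (x i)) (xy i) (hpmkE _ i)).
have DF := plq_on_prod (fun i => plq_on_edom (let: And4 _ _ _ H := phiP i in H)).
have Fconv := convex_on_prod (fun i =>
  convex_on_edom (phi_proper i) (let: And4 _ _ H _ := phiP i in H)).
have imp : implementable S0 S1 (partial_inverse S M).
  apply: (plq_implementable S0S SS1 DF Fconv _ Dx Fx).
  - exact: subdiff_sepsum.
  - by rewrite memv_ker Lx.
  - apply/ocomplP => v; rewrite memv_ker sumlfunE => /eqP Lv.
    have Lvy : \sum_i inner (L i (v i)) y = 0 by rewrite -inner_suml Lv inner0l.
    rewrite hprod_innerE -[RHS]oppr0 -[X in _ = - X]Lvy -sumrN.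
    by apply: eq_bigr => i _; rewrite hpmkE innerNl adjointP innerC.
split=> //; apply: projected_maximal => //.
by apply: partial_inverse_monotone; exact: subdiff_monotone.
Qed.
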